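(* Let $0<4\alpha\leq 1$, $0<2\beta\leq 1$, $1/2-\alpha/4\leq\gamma<1$, $K\geq 0$, and let $n\geq(42K+4)/(\alpha^{2}\beta)$. If $G$ is a graph of order $n$ with \[ \mu(G)>\gamma n-K/n\quad\text{and}\quad \delta(G)\leq(\gamma-\alpha)n, \] then there exists an induced subgraph $H$ of $G$ with $|H|\geq(1-\beta)n$ satisfying at least one of the following conditions: (i) $\mu(H)>\gamma(1+\beta\alpha/2)|H|$; (ii) $\mu(H)>\gamma|H|$ and $\delta(H)>(\gamma-\alpha)|H|$.
   Context: Graphs are finite and simple. $\mu(G)$ denotes the largest eigenvalue of the adjacency matrix of $G$, $|G|$ the number of vertices of $G$, and $\delta(G)$ the minimum degree of $G$. *)

(* Defs.v *)
From HB Require Import structures.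
From mathcomp Require Import all_boot all_order all_algebra.
From mathcomp Require Import polyrcf.
From mathcomp Require Import reals.
Set Implicit Arguments. Unset Strict Implicit. Unset Printing Implicit Defensive.
Import Order.TTheory GRing.Theory Num.Theory.
Local Open Scope ring_scope.

Definition simple_graph (V : finType) (e : rel V) : Prop :=
  symmetric e /\ irreflexive e.

Definition adjmx (R : nzRingType) (V : finType) (e : rel V) : 'M[R]_#|V| :=
  \matrix_(i, j) (e (enum_val i) (enum_val j))%:R.

(* mu(G): the largest eigenvalue of the adjacency matrix. The real eigenvalues
   are the real roots of the characteristic polynomial; rootsR lists them
   sorted increasingly, so the largest one is the last element.
   (For the empty graph, default 0.) *)
Definition mu (R : rcfType) (V : finType) (e : rel V) : R :=
  last 0 (rootsR (char_poly (adjmx R e))).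

(* minimum degree; for an empty vertex set it is #|V| = 0 *)
Definition mindeg (V : finType) (e : rel V) : nat :=
  \big[minn/#|V|]_(x : V) #|[set y | e x y]|.

Definition induced (V : finType) (e : rel V) (S : {set V}) :
  rel {x : V | x \in S} := fun x y => e (val x) (val y).
Arguments induced {V} e S _ _.

(* Main.v *)
Require Import Defs.
From HB Require Import structures.
From mathcomp Require Import all_boot all_order all_algebra.
From mathcomp Require Import spectral complex.
From mathcomp Require Import polyrcf reals ring lra.
Set Implicit Arguments. Unset Strict Implicit. Unset Printing Implicit Defensive.
Import Order.TTheory GRing.Theory Num.Theory.
Local Open Scope ring_scope.

(** Delete vertices one at a time.  Let [x] be a unit eigenvector of [mu(G)],
    [m = |G|], [d = delta(G)], and let [s] be the least of the squares of the
    entries of [x], attained at [w].  Restricting [x] to [G - w] in the Rayleigh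
    quotient gives [mu(G - w) (1 - s) >= mu(G) (1 - 2 s)], while the eigenvalue
    equation at a vertex of minimum degree and Cauchy-Schwarz give
    [s (mu(G)^2 + d (m - d)) <= d].  If [d <= (gamma - alpha) m] and [mu(G) / m]
    is not much less than [gamma], the latter forces [m s <= 1 - alpha], and then
    the former says that [mu(G) / m] grows by at least
    [3 gamma alpha / (4 n)] when [w] is deleted.  One such step already makes up
    for the deficit [K / n^2], so if the deletion stops because the minimum degree
    has become large, (ii) holds; otherwise it goes on for [floor(beta n)] steps,
    and the accumulated gain gives (i). *)

(** * The spectral theorem and Rayleigh quotients of real symmetric matrices *)

Section SpectralDecomposition.
Local Open Scope sesquilinear_scope.
Local Open Scope complex_scope.

Lemma map_complex_trmxC (R : rcfType) m p (B : 'M[R]_(m, p)) :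
  (map_mx (real_complex R) B)^t* = map_mx (real_complex R) B^T.
Proof. by apply/matrixP=> i j; rewrite !mxE; apply: conjc_real. Qed.

(** Over [R[i]] a real symmetric matrix is Hermitian, so the complex spectral theorem applies. Its
    eigenvalues are real, hence equal to their real parts, which form [d]; [P] may stay complex,
    which suffices for bounding quadratic forms. *)
Lemma symmetric_spectral (R : rcfType) n (A : 'M[R]_n) : A^T = A ->
  exists (P : 'M[R[i]]_n) (d : 'rV[R]_n), P \is unitarymx /\
    map_mx (real_complex R) A =
      P^t* *m diag_mx (map_mx (real_complex R) d) *m P.
Proof.
move=> Asym; set AC := map_mx _ A.
have ACherm : AC \is hermsymmx.
  by apply/is_hermitianmxP; rewrite expr0 scale1r map_complex_trmxC Asym.
exists (spectralmx AC), (map_mx (@complex.Re R) (spectral_diag AC)).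
split; first exact: spectral_unitarymx.
have <- : spectral_diag AC =
    map_mx (real_complex R) (map_mx (@complex.Re R) (spectral_diag AC)).
  apply/matrixP=> i j; rewrite !mxE RRe_real //.
  exact: (mxOverP (hermitian_spectral_diag_real ACherm)).
rewrite -invmx_unitary ?spectral_unitarymx //.
exact/orthomx_spectralP/hermitian_normalmx.
Qed.

Lemma quadform_diag_mx (C : numClosedFieldType) n (y d : 'rV[C]_n) :
  (y *m diag_mx d *m y^t*) 0 0 = \sum_i d 0 i * `|y 0 i| ^+ 2.
Proof.
rewrite mxE; apply: eq_bigr => i _.
by rewrite mul_mx_diag !mxE normCK mulrAC mulrC mulrA.
Qed.

(** In the coordinates [y] of [v] the form is a sum of squared moduli weighted by the [d 0 i], hence
    at most the largest weight times the squared norm. Each [d 0 i] is a root because row [i] of [P]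
    is an eigenvector. *)
Lemma rayleigh_le_root (R : rcfType) n (A : 'M[R]_n) (v : 'rV[R]_n) : A^T = A ->
  (0 < n)%N ->
  exists2 l, root (char_poly A) l & (v *m A *m v^T) 0 0 <= l * (v *m v^T) 0 0.
Proof.
move=> Asym n_gt0; have [P [d [Pu AE]]] := symmetric_spectral Asym.
set toC := real_complex R.
have d_root i : root (char_poly A) (d 0 i).
  rewrite -(fmorph_root toC) map_char_poly -eigenvalue_root_char.
  apply/eigenvalueP; exists (row i P).
    rewrite AE rowE -!mulmxA !(mulmxA P) (unitarymxP Pu) mul1mx mulmxA.
    by rewrite -[_ *m diag_mx _]rowE row_diag_mx -scalemxAl mxE.
  apply: contraTneq isT => /(congr1 (fun X => X *m P^t*)).
  rewrite mul0mx rowE -mulmxA (unitarymxP Pu) mulmx1 => /rowP/(_ i).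
  by rewrite !mxE !eqxx => /eqP; rewrite oner_eq0.
have [i0 _ dmax] := @arg_maxP _ _ _ (Ordinal n_gt0) xpredT (d 0) isT.
exists (d 0 i0) => //; rewrite -lecR rmorphM /=.
set y := map_mx toC v *m P^t*.
have -> : ((v *m A *m v^T) 0 0)%:C = \sum_i (d 0 i)%:C * `|y 0 i| ^+ 2.
  transitivity ((y *m diag_mx (map_mx toC d) *m y^t*) 0 0); last first.
    by rewrite quadform_diag_mx; apply: eq_bigr => i _; rewrite mxE.
  rewrite /y trmx_mul map_mxM trmxCK map_complex_trmxC !mulmxA.
  rewrite -(mulmxA _ _ (diag_mx _)) -(mulmxA _ _ P) -AE.
  by rewrite -!map_mxM [RHS]mxE.
have -> : ((v *m v^T) 0 0)%:C = \sum_i `|y 0 i| ^+ 2.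
  transitivity ((y *m y^t*) 0 0); last first.
    by rewrite mxE; apply: eq_bigr => i _; rewrite !mxE normCK.
  rewrite /y trmx_mul map_mxM trmxCK map_complex_trmxC !mulmxA.
  by rewrite mulmxKtV // -!map_mxM [RHS]mxE.
rewrite mulr_sumr; apply: ler_sum => i _.
by rewrite ler_wpM2r ?exprn_ge0 // lecR; apply: dmax.
Qed.

End SpectralDecomposition.

(** * [mu] as the largest root, its eigenfunctions and Rayleigh quotients *)

Lemma char_poly_neq0 (R : nzRingType) n (A : 'M[R]_n) : char_poly A != 0.
Proof. exact/monic_neq0/char_poly_monic. Qed.

Lemma mem_rootsR (R : rcfType) (p : {poly R}) x :
  p != 0 -> (x \in rootsR p) = root p x.
Proof. by move=> p_neq0; rewrite -roots_on_rootsR // itv_boundlr. Qed.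

Lemma root_le_mu (R : rcfType) (V : finType) (e : rel V) l :
  root (char_poly (adjmx R e)) l -> l <= mu R e.
Proof.
rewrite -mem_rootsR ?char_poly_neq0 // /mu.
have := sorted_roots (- cauchy_bound (char_poly (adjmx R e)))
  (cauchy_bound (char_poly (adjmx R e))) (char_poly (adjmx R e)).
rewrite -/(rootsR _); case/lastP: (rootsR _) => // s x.
rewrite last_rcons mem_rcons inE -cats1 sorted_pairwise; last exact: lt_trans.
rewrite pairwise_cat allrel1r => /andP[/allP lt_sx _] /predU1P[-> //|/lt_sx].
exact: ltW.
Qed.

Lemma adjmx_tr (R : nzRingType) (V : finType) (e : rel V) :
  symmetric e -> (adjmx R e)^T = adjmx R e.
Proof. by move=> e_sym; apply/matrixP=> i j; rewrite !mxE e_sym. Qed.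

Lemma mu_root (R : rcfType) (V : finType) (e : rel V) :
  symmetric e -> (0 < #|V|)%N -> root (char_poly (adjmx R e)) (mu R e).
Proof.
(* The zero vector serves only to produce some real root, so that [last] does not return its default
   0. *)
move=> e_sym V_gt0; have [l] := rayleigh_le_root 0 (adjmx_tr R e_sym) V_gt0.
rewrite -!mem_rootsR ?char_poly_neq0 // /mu.
by case: (rootsR _) => [|x s _ _]; [rewrite in_nil | exact: (mem_last x s)].
Qed.

Lemma sum_enum_val (R : nmodType) (V : finType) (F : V -> R) :
  \sum_(i < #|V|) F (enum_val i) = \sum_x F x.
Proof. by rewrite -(big_enum_val (A := V) F). Qed.

Lemma rayleigh_mu (R : rcfType) (V : finType) (e : rel V) (f : V -> R) :
  symmetric e ->
  \sum_x \sum_y (e x y)%:R * f x * f y <= mu R e * \sum_x f x ^+ 2.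
Proof.
move=> e_sym; have [V_eq0|V_gt0] := posnP #|V|.
  by rewrite !big1 ?mulr0 // => x; have := card0_eq V_eq0 x.
pose v : 'rV[R]_#|V| := \row_i f (enum_val i).
have vE : (v *m v^T) 0 0 = \sum_x f x ^+ 2.
  by rewrite mxE -[RHS]sum_enum_val; apply: eq_bigr => i _; rewrite !mxE expr2.
have vAE : (v *m adjmx R e *m v^T) 0 0 = \sum_x \sum_y (e x y)%:R * f x * f y.
  rewrite exchange_big mxE -[RHS]sum_enum_val; apply: eq_bigr => j _.
  rewrite -[RHS]sum_enum_val !mxE mulr_suml; apply: eq_bigr => i _.
  by rewrite !mxE (mulrC (f _)).
have [l /root_le_mu l_le] := rayleigh_le_root v (adjmx_tr R e_sym) V_gt0.
rewrite vE vAE => /le_trans; apply; apply: ler_wpM2r l_le.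
by apply: sumr_ge0 => x _; apply: sqr_ge0.
Qed.

Lemma mu_eigenfunction (R : rcfType) (V : finType) (e : rel V) :
  symmetric e -> (0 < #|V|)%N ->
  exists2 f : V -> R, 0 < \sum_x f x ^+ 2 &
    forall x, \sum_y (e x y)%:R * f y = mu R e * f x.
Proof.
move=> e_sym V_gt0; have := mu_root R e_sym V_gt0.
rewrite -eigenvalue_root_char => /eigenvalueP[v vA v_neq0].
exists (fun x => v 0 (enum_rank x)) => [|x].
  rewrite lt_def sumr_ge0 ?andbT => [|x _]; last exact: sqr_ge0.
  apply: contraNneq v_neq0 => /psumr_eq0P v_eq0.
  apply/eqP/rowP=> i; rewrite mxE -(enum_valK i).
  by apply/eqP; rewrite -sqrf_eq0 v_eq0 // => j _; apply: sqr_ge0.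
have /rowP/(_ (enum_rank x)) := vA; rewrite !mxE => <-.
rewrite -[LHS]sum_enum_val; apply: eq_bigr => i _.
by rewrite !mxE enum_valK enum_rankK e_sym mulrC.
Qed.

(** * Induced subgraphs: eigenfunctions and minimum degrees *)

Lemma rayleigh_mu_induced (R : rcfType) (V : finType) (e : rel V)
    (S : {set V}) (f : V -> R) : symmetric e ->
  \sum_(x in S) \sum_(y in S) (e x y)%:R * f x * f y <=
    mu R (induced e S) * \sum_(x in S) f x ^+ 2.
Proof.
move=> e_sym; rewrite (big_sub (mem S)) [X in _ * X](big_sub (mem S)).
under eq_bigr => x _ do rewrite (big_sub (mem S)).
by apply: (rayleigh_mu (fun x => f (val x))) => x y; apply: e_sym.
Qed.

Lemma mu_induced_eigenfunction (R : rcfType) (V : finType) (e : rel V)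
    (S : {set V}) : symmetric e -> (0 < #|S|)%N ->
  exists2 f : V -> R, 0 < \sum_(x in S) f x ^+ 2 &
    forall x, x \in S ->
      \sum_(y in S) (e x y)%:R * f y = mu R (induced e S) * f x.
Proof.
move=> e_sym S_gt0.
have [||f f_gt0 fE] := @mu_eigenfunction R _ (induced e S).
- by move=> x y; apply: e_sym.
- by rewrite card_sig.
have fK (x : {x | x \in S}) : oapp f 0 (insub (val x)) = f x by rewrite valK.
(* Extension by 0 outside [S], so that sums can run over subsets of [V]. *)
exists (fun x => oapp f 0 (insub x)) => [|x xS].
  by rewrite (big_sub (mem S)); under eq_bigr => x _ do rewrite fK.
rewrite (big_sub (mem S)); under eq_bigr => y _ do rewrite fK.
by rewrite (insubT (mem S) xS) -fE.
Qed.

Lemma mindeg_attained (V : finType) (e : rel V) : (0 < #|V|)%N ->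
  exists x, mindeg e = #|[set y | e x y]|.
Proof.
move=> /card_gt0P[x0 _]; rewrite /mindeg.
have [||x _ ->] := @eq_bigmin _ nat V #|V| x0 xpredT (fun x => #|[set y | e x y]|).
- by [].
- by move=> x _; apply: max_card.
by exists x.
Qed.

Lemma card_induced_nbhd (V : finType) (e : rel V) (S : {set V})
    (x : {x | x \in S}) :
  #|[set y | induced e S x y]| = #|[set y in S | e (val x) y]|.
Proof.
rewrite -(card_imset _ val_inj); apply: eq_card => y; rewrite inE.
apply/imsetP/andP => [[z + ->]|[yS exy]]; first by rewrite inE (valP z).
by exists (Sub y yS); rewrite ?inE.
Qed.

Lemma mindeg_induced_attained (V : finType) (e : rel V) (S : {set V}) :
  (0 < #|S|)%N ->
  exists2 x, x \in S & mindeg (induced e S) = #|[set y in S | e x y]|.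
Proof.
move=> S_gt0; have [|x ->] := @mindeg_attained _ (induced e S).
  by rewrite card_sig.
by exists (val x); [apply: valP | apply: card_induced_nbhd].
Qed.

(** The iteration starts from the full vertex set, whose induced graph lives on another type.
    Testing an eigenfunction of [e] in the Rayleigh quotient of this copy avoids identifying the two
    matrices. *)
Lemma mu_le_induced_setT (R : rcfType) (V : finType) (e : rel V) :
  symmetric e -> (0 < #|V|)%N -> mu R e <= mu R (induced e [set: V]).
Proof.
move=> e_sym V_gt0; have [f f_gt0 fE] := mu_eigenfunction R e_sym V_gt0.
have setTE (F : V -> R) : \sum_(x in [set: V]) F x = \sum_x F x.
  by apply: eq_bigl => x; rewrite inE.
have := rayleigh_mu_induced [set: V] f e_sym; rewrite !setTE.
under eq_bigr do rewrite setTE.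
move=> le_f; rewrite -(ler_pM2r f_gt0); apply: le_trans le_f.
rewrite mulr_sumr ler_sum // => x _.
rewrite expr2 mulrA -fE mulr_suml ler_sum // => y _.
by rewrite mulrAC.
Qed.

Lemma mindeg_induced_setT_le (V : finType) (e : rel V) : (0 < #|V|)%N ->
  (mindeg (induced e [set: V]) <= mindeg e)%N.
Proof.
move=> V_gt0; have [x ->] := mindeg_attained e V_gt0.
have -> : #|[set y | e x y]| = #|[set y | induced e _ (Sub x (in_setT x)) y]|.
  by rewrite card_induced_nbhd; apply: eq_card => y; rewrite !inE.
exact: (@bigmin_le _ nat).
Qed.

(** * Deletion of one vertex *)

Lemma sqr_sum_le_card (R : realDomainType) (I : finType) (A : {set I})
    (f : I -> R) :
  (\sum_(i in A) f i) ^+ 2 <= #|A|%:R * \sum_(i in A) f i ^+ 2.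
Proof.
have [A0|A_gt0] := posnP #|A|.
  by rewrite (cards0_eq A0) !big_set0 cards0 expr2 !mul0r.
set s := \sum_(i in A) f i; set q := \sum_(i in A) f i ^+ 2.
(* Cauchy-Schwarz as nonnegativity of a variance, scaled by [#|A|] to avoid division. *)
have : 0 <= \sum_(i in A) (#|A|%:R * f i - s) ^+ 2.
  by apply: sumr_ge0 => i _; apply: sqr_ge0.
have -> : \sum_(i in A) (#|A|%:R * f i - s) ^+ 2 =
    #|A|%:R * (#|A|%:R * q - s ^+ 2).
  transitivity (\sum_(i in A)
      (#|A|%:R ^+ 2 * f i ^+ 2 - 2 * #|A|%:R * s * f i + s ^+ 2)).
    by apply: eq_bigr => i _; ring.
  rewrite !big_split /= sumrN -!mulr_sumr sumr_const -/s -/q -mulr_natr.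
  ring.
by rewrite pmulr_rge0 ?ltr0n // subr_ge0.
Qed.

Lemma vertex_deletion (R : rcfType) (V : finType) (e : rel V) (S : {set V}) :
  simple_graph e -> (0 < #|S|)%N ->
  let d : R := (mindeg (induced e S))%:R in
  let m : R := #|S|%:R in
  exists2 w, w \in S & exists s : R, [/\ 0 <= s,
    s * (mu R (induced e S) ^+ 2 + d * (m - d)) <= d &
    mu R (induced e S) * (1 - 2 * s) <= mu R (induced e (S :\ w)) * (1 - s)].
Proof.
move=> [e_sym e_irr] S_gt0 d m; set l := mu R _.
have [f f_gt0 fE] := mu_induced_eigenfunction R e_sym S_gt0.
have [u uS dE] := mindeg_induced_attained e S_gt0.
set T := \sum_(x in S) f x ^+ 2 in f_gt0.
have [w wS w_min] := @arg_minP _ _ _ u (mem S) (fun x => f x ^+ 2) uS.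
exists w => //; exists (f w ^+ 2 / T).
have TN0 : T != 0 by rewrite gt_eqF.
split; first by rewrite divr_ge0 ?sqr_ge0 ?ltW.
  pose N := [set y in S | e u y].
  have NS : N \subset S by apply/subsetP=> y; rewrite inE => /andP[].
  have dN : d = #|N|%:R by rewrite /d dE.
  have sumN : l * f u = \sum_(y in N) f y.
    rewrite -fE // [RHS]big_mkcond [LHS]big_mkcond; apply: eq_bigr => y _.
    rewrite inE; case: (y \in S) => //=.
    by case: (e u y); rewrite ?mul1r ?mul0r.
  have cs : (l * f u) ^+ 2 <= d * \sum_(y in N) f y ^+ 2.
    by rewrite sumN dN; apply: sqr_sum_le_card.
  (* Each of the [m - d] vertices of [S] outside [N] contributes at least the minimal square. *)
  have restT : \sum_(y in N) f y ^+ 2 + (m - d) * f w ^+ 2 <= T.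
    have -> : T = \sum_(y in N) f y ^+ 2 + \sum_(y in S :\: N) f y ^+ 2.
      rewrite /T (big_setID N) /=; congr (_ + _).
      by rewrite (setIidPr NS).
    rewrite lerD2l; have -> : m - d = #|S :\: N|%:R.
      by rewrite cardsDS // natrB ?subset_leq_card // dN.
    rewrite mulr_natl -sumr_const ler_sum // => y.
    by rewrite inE => /andP[_ yS]; apply: w_min.
  have lu : l ^+ 2 * f w ^+ 2 <= (l * f u) ^+ 2.
    by rewrite exprMn ler_wpM2l ?sqr_ge0 ?w_min.
  rewrite mulrAC ler_pdivrMr //.
  have d_ge0 : 0 <= d by rewrite ler0n.
  have := ler_wpM2l d_ge0 restT.
  nra.
have lS' : l * (T - 2 * f w ^+ 2) <= mu R (induced e (S :\ w)) * (T - f w ^+ 2).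
  have := rayleigh_mu_induced (S :\ w) f e_sym.
  have TE : \sum_(x in S :\ w) f x ^+ 2 = T - f w ^+ 2.
    by rewrite /T [X in _ = X - _](big_setD1 w) //= addrAC subrr add0r.
  (* Equality holds: the form on [S] is [l * T], and the row and the column of [w] each remove
     [l * f w ^+ 2], with no overlap since there is no loop at [w]. *)
  rewrite TE; apply: le_trans; rewrite le_eqVlt; apply/orP; left; apply/eqP.
  transitivity (\sum_(x in S :\ w) (l * f x ^+ 2 - f w * ((e w x)%:R * f x))).
    rewrite sumrB -!mulr_sumr TE.
    have -> : \sum_(x in S :\ w) (e w x)%:R * f x = l * f w.
      by rewrite -fE // [RHS](big_setD1 w) //= e_irr mul0r add0r.
    ring.
  apply: eq_bigr => x; rewrite inE => /andP[_ xS].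
  transitivity (f x * \sum_(y in S) (e x y)%:R * f y - f w * ((e w x)%:R * f x)).
    by rewrite fE // -/l; ring.
  rewrite (big_setD1 w) //= mulrDr mulr_sumr e_sym.
  under [RHS]eq_bigr do rewrite mulrAC mulrC.
  ring.
have -> : 1 - 2 * (f w ^+ 2 / T) = (T - 2 * f w ^+ 2) / T by field.
have -> : 1 - f w ^+ 2 / T = (T - f w ^+ 2) / T by field.
by rewrite !(mulrA _ _ T^-1) ler_pM2r ?invr_gt0.
Qed.

(** * Numerical estimates for one deletion *)

Lemma min_weight_le (R : realFieldType) (alpha gamma eps m d l s : R) :
  0 < alpha -> alpha <= 1 / 4 -> 1 / 2 - alpha / 4 <= gamma -> gamma < 1 ->
  0 <= eps -> eps <= alpha / 100 -> 0 < m -> 0 <= d ->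
  d <= (gamma - alpha) * m -> (gamma - eps) * m <= l -> 0 <= s ->
  s * (l ^+ 2 + d * (m - d)) <= d -> m * s <= 1 - alpha.
Proof.
move=> a0 a4 g1 g2 e0 e1 m0 d0 dle lle s0 sle.
pose t := d / m; pose g := l / m; pose p := m * s.
have mN0 : m != 0 by rewrite gt_eqF.
have t0 : 0 <= t by rewrite divr_ge0 // ltW.
have tle : t <= gamma - alpha by rewrite ler_pdivrMr.
have gle : gamma - eps <= g by rewrite ler_pdivlMr.
have ple : p * (g ^+ 2 + t * (1 - t)) <= t.
  rewrite -(ler_pM2r m0); apply: le_trans (_ : d <= _); last by rewrite divfK.
  apply: le_trans sle; rewrite le_eqVlt; apply/orP; left; apply/eqP.
  rewrite /p /g /t; field.
  by [].
(* If [p > 1 - alpha], then [(1 - alpha) * g ^+ 2 <= t * (alpha + (1 - alpha) * t)]. The right side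
   increases with [t]; at [t = gamma - alpha] it falls short of [(1 - alpha) * gamma ^+ 2] by [alpha
   * (gamma * (1 - 2 * alpha) + alpha ^+ 2)], more than [eps] can absorb. *)
rewrite -/p leNgt; apply/negP => plt.
have g2le : gamma ^+ 2 - 2 * eps <= g ^+ 2.
  apply: le_trans (_ : (gamma - eps) ^+ 2 <= _); first by nra.
  by rewrite ler_sqr ?nnegrE; lra.
have X0 : 0 <= g ^+ 2 + t * (1 - t).
  by rewrite addr_ge0 ?sqr_ge0 // mulr_ge0 //; lra.
have h1 : (1 - alpha) * (g ^+ 2 + t * (1 - t)) <= t.
  by apply: le_trans ple; rewrite ler_wpM2r // ltW.
have h2 : t * (alpha + (1 - alpha) * t) <=
    (gamma - alpha) * (alpha + (1 - alpha) * (gamma - alpha)).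
  have a1 : 0 <= 1 - alpha by lra.
  have u0 : 0 <= (1 - alpha) * t by apply: mulr_ge0.
  apply: ler_pM => //; first lra.
  by rewrite lerD2l ler_wpM2l.
have h3 : (1 - alpha) * (gamma ^+ 2 - 2 * eps) <= (1 - alpha) * g ^+ 2.
  by rewrite ler_wpM2l //; lra.
(* Here [gamma >= 7 / 16] and [1 - 2 * alpha >= 1 / 2]. *)
have h4 : alpha * (7 / 32) <= alpha * (gamma * (1 - 2 * alpha) + alpha ^+ 2).
  apply: ler_wpM2l; [exact: ltW | have := sqr_ge0 alpha].
  have : 0 <= (gamma - 7 / 16) * (1 / 2 - 2 * alpha) by apply: mulr_ge0; lra.
  lra.
have ae : 0 <= alpha * eps by rewrite mulr_ge0 // ltW.
lra.
Qed.

(** The difference [m * (1 - 2 * s) - (m - 1) * (1 - s)] is [1 - m * s - s >= alpha - s], and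
    [s <= alpha / 16] leaves the factor 15/16. *)
Lemma density_gain (R : realFieldType) (alpha m l l' s : R) :
  0 < alpha -> 16 <= alpha * m -> 1 < m -> 0 <= l -> 0 <= s ->
  m * s <= 1 - alpha -> l * (1 - 2 * s) <= l' * (1 - s) ->
  l / m * (1 + 15 / 16 * alpha / m) <= l' / (m - 1).
Proof.
move=> a0 am m1 l0 s0 ms le_ll'.
have m0 : 0 < m by lra.
have s1 : 0 < 1 - s by nra.
have mN0 : m != 0 by rewrite gt_eqF.
rewrite ler_pdivlMr ?subr_gt0 // -(ler_pM2r s1); apply: le_trans le_ll'.
pose k := 15 / 16 * alpha / m.
have km : k * m = 15 / 16 * alpha by rewrite divfK.
have k0 : 0 <= k by apply: divr_ge0; lra.
rewrite -/k -(ler_pM2r m0).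
have -> : l / m * (1 + k) * (m - 1) * (1 - s) * m =
  l * ((1 + k) * (m - 1) * (1 - s)) by field.
rewrite -[leRHS]mulrA ler_wpM2l //.
have sa : s <= alpha / 16.
  have := ler_wpM2l s0 am; have := ler_wpM2l (ltW a0) ms.
  have := sqr_ge0 alpha; lra.
have : 0 <= k * (1 + (m - 1) * s).
  by rewrite mulr_ge0 // addr_ge0 // mulr_ge0 // subr_ge0 ltW.
lra.
Qed.

Lemma deletion_density_gain (R : rcfType) (V : finType) (e : rel V)
    (S : {set V}) (alpha gamma eps : R) :
  0 < alpha -> alpha <= 1 / 4 -> 1 / 2 - alpha / 4 <= gamma -> gamma < 1 ->
  0 <= eps -> eps <= alpha / 100 -> simple_graph e ->
  16 <= alpha * #|S|%:R -> (mindeg (induced e S))%:R <= (gamma - alpha) * #|S|%:R ->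
  (gamma - eps) * #|S|%:R <= mu R (induced e S) ->
  exists2 w, w \in S &
    mu R (induced e S) / #|S|%:R + 3 / 4 * (gamma * alpha) / #|S|%:R <=
    mu R (induced e (S :\ w)) / #|S :\ w|%:R.
Proof.
move=> a0 a4 g1 g2 e0 e1 eG am dle lle; set m : R := #|S|%:R in am dle lle *.
have m64 : 64 <= m.
  have : alpha * m <= 1 / 4 * m by rewrite ler_wpM2r // ler0n.
  lra.
have S_gt0 : (0 < #|S|)%N by rewrite -(ltr0n R) -/m; lra.
have m0 : 0 < m by lra.
have [w wS [s [s0 sle le_mu]]] := vertex_deletion R eG S_gt0.
exists w => //; set l := mu R (induced e S) in sle le_mu lle *.
have ms : m * s <= 1 - alpha.
  by apply: (min_weight_le a0 a4 g1 g2 e0 e1 m0 (ler0n _ _) dle lle).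
have -> : #|S :\ w|%:R = m - 1 :> R.
  by rewrite /m (cardsD1 w S) wS natrD addrAC subrr add0r.
have gm : gamma - eps <= l / m by rewrite ler_pdivlMr.
have l0 : 0 <= l.
  by apply: le_trans lle; rewrite mulr_ge0 //; lra.
have m1 : 1 < m by lra.
apply: le_trans (density_gain a0 am m1 l0 s0 ms le_mu).
(* Lowering 15/16 to 3/4 pays for replacing [l / m >= gamma - eps] by [gamma]. *)
rewrite mulrDr mulr1 lerD2l !mulrA ler_pM2r ?invr_gt0 //.
have : (gamma - eps) * alpha <= l / m * alpha by rewrite ler_wpM2r // ltW.
have : eps * alpha <= alpha / 100 * alpha by rewrite ler_wpM2r // ltW.
have : 0 <= (gamma - 7 / 16) * alpha by rewrite mulr_ge0; lra.
have : 0 <= alpha * (1 / 4 - alpha) by rewrite mulr_ge0; lra.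
lra.
Qed.

(** * Iterated deletion and the choice of constants *)

Theorem theorem3 (R : realType) (alpha beta gamma K : R) (n : nat)
  (e : rel 'I_n) :
  0 < 4 * alpha -> 4 * alpha <= 1 ->
  0 < 2 * beta -> 2 * beta <= 1 ->
  1 / 2 - alpha / 4 <= gamma -> gamma < 1 ->
  0 <= K ->
  (42 * K + 4) / (alpha ^+ 2 * beta) <= n%:R ->
  simple_graph e ->
  mu R e > gamma * n%:R - K / n%:R ->
  (mindeg e)%:R <= (gamma - alpha) * n%:R ->
  exists S : {set 'I_n},
    (1 - beta) * n%:R <= #|S|%:R /\
    ( mu R (induced e S) > gamma * (1 + beta * alpha / 2) * #|S|%:R
      \/ (mu R (induced e S) > gamma * #|S|%:R /\
          (mindeg (induced e S))%:R > (gamma - alpha) * #|S|%:R)).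
Proof.
move=> a0 a4 b0 b2 g1 g2 K0 nle eG mu_gt deg_le; set concl := exists S, _.
have {}a0 : 0 < alpha by lra.
have {}b0 : 0 < beta by lra.
have {}a4 : alpha <= 1 / 4 by lra.
have {b2} b2 : beta <= 1 / 2 by lra.
set N : R := n%:R in nle mu_gt deg_le concl *.
have ab0 : 0 < alpha ^+ 2 * beta by rewrite mulr_gt0 ?exprn_gt0.
have {}nle : 42 * K + 4 <= N * (alpha ^+ 2 * beta) by rewrite -ler_pdivrMr.
have N0 : 0 < N.
  by rewrite -(pmulr_lgt0 _ ab0); apply: lt_le_trans nle; lra.
have n_gt0 : (0 < n)%N by rewrite -(ltr0n R).
have NN0 : N != 0 by rewrite gt_eqF.
have ab8 : alpha * beta <= 1 / 8.
  have := ler_pM (ltW a0) (ltW b0) a4 b2; lra.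
(* At most half of the vertices get deleted, so 32 here keeps [alpha * #|S|] at least 16. *)
have Na : 32 <= alpha * N.
  have : alpha * N * (alpha * beta) <= alpha * N * (1 / 8).
    by apply: ler_wpM2l => //; rewrite mulr_ge0 ?ltW.
  lra.
have N128 : 128 <= N.
  have : alpha * N <= 1 / 4 * N by rewrite ler_wpM2r // ltW.
  lra.
set eps := K / N ^+ 2.
have eps0 : 0 <= eps by rewrite divr_ge0 // exprn_ge0 // ltW.
have epsN : 42 * eps * N <= alpha ^+ 2 * beta.
  rewrite /eps (_ : 42 * _ * N = 42 * K / N); last by field.
  by rewrite ler_pdivrMr //; lra.
have epsab : eps <= alpha * beta / 1000.
  have : eps * 128 <= eps * N by rewrite ler_wpM2l.
  have : alpha * (alpha * beta) <= 1 / 4 * (alpha * beta).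
    by rewrite ler_wpM2r // mulr_ge0 ?ltW.
  have : 0 < alpha * beta by rewrite mulr_gt0.
  lra.
have epsa : eps <= alpha / 100.
  have : alpha * beta <= alpha * (1 / 2) by rewrite ler_wpM2l // ltW.
  lra.
(* A gain per deletion valid at every stage, since [#|S| <= N]. *)
set eta := 3 / 4 * (gamma * alpha) / N.
have etaN : eta * N = 3 / 4 * (gamma * alpha) by rewrite divfK.
have ga0 : 7 / 16 * alpha <= gamma * alpha by apply: ler_wpM2r; lra.
have eps_eta : eps < eta.
  rewrite -(ltr_pM2r N0) etaN.
  have : alpha * (alpha * beta) <= alpha * (1 / 8) by rewrite ler_wpM2l // ltW.
  lra.
have bN0 : 0 <= beta * N by rewrite mulr_ge0 ?ltW.
have /andP[trunc_le trunc_gt] := truncn_itv bN0.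
set k0 := Num.trunc _ in trunc_le trunc_gt.
(* Invariant: unless the goal is already reached, [k] deletions have raised the density by [k * eta]
   and the minimum degree is still small. The case [k = k0] gives (i). *)
suff iter k : (k <= k0)%N -> concl \/ exists S : {set 'I_n}, [/\
    (#|S| + k)%N = n,
    (gamma - eps + k%:R * eta) * #|S|%:R <= mu R (induced e S) &
    (mindeg (induced e S))%:R <= (gamma - alpha) * #|S|%:R].
  have [//|[S [Sk mu_ge _]]] := iter k0 (leqnn _).
  have SN : #|S|%:R = N - k0%:R by apply/eqP; rewrite eq_sym subr_eq -natrD Sk.
  have S0 : 0 < #|S|%:R :> R.
    rewrite SN; have : beta * N <= 1 / 2 * N by rewrite ler_wpM2r // ltW.
    lra.
  exists S; split; first by rewrite SN; lra.
  left; apply: lt_le_trans mu_ge; rewrite ltr_pM2r //.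
  rewrite -natr1 in trunc_gt.
  have eta0 : 0 < eta by lra.
  (* In units of [gamma * alpha * beta], [beta * N] steps would gain 3/4. Rounding down costs at
     most one [eta <= 3/16], and [eps] is less than the remaining 1/16 above the required 1/2. *)
  have : (beta * N) * eta < (k0%:R + 1) * eta by rewrite ltr_pM2r.
  have bN4 : 4 <= beta * N.
    have : alpha ^+ 2 * (beta * N) <= 1 * (beta * N).
      by rewrite ler_wpM2r // expr_le1 //; lra.
    lra.
  have etab : eta <= 3 / 16 * (gamma * alpha * beta).
    rewrite -(ler_pM2r N0) etaN.
    have : gamma * alpha * 4 <= gamma * alpha * (beta * N).
      by rewrite ler_wpM2l //; lra.
    lra.
  have : 0 < alpha * beta by rewrite mulr_gt0.
  have : 7 / 16 * (alpha * beta) <= gamma * (alpha * beta).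
    by apply: ler_wpM2r; [rewrite mulr_ge0 ?ltW | lra].
  have : (beta * N) * eta = beta * (3 / 4 * (gamma * alpha)) by rewrite -etaN; ring.
  lra.
elim: k => [_|k IHk lt_k].
  right; exists [set: 'I_n]; rewrite cardsT card_ord; split; first by rewrite addn0.
    have := mu_le_induced_setT R (proj1 eG); rewrite card_ord => /(_ n_gt0).
    apply: le_trans; rewrite mul0r addr0; apply: ltW; apply: le_lt_trans mu_gt.
    by rewrite /eps le_eqVlt; apply/orP; left; apply/eqP; rewrite -/N; field.
  apply: le_trans deg_le; rewrite ler_nat.
  by apply: mindeg_induced_setT_le; rewrite card_ord.
have [concl_holds|[S [Sk mu_ge dle]]] := IHk (ltnW lt_k); first by left.
have SN : #|S|%:R = N - k%:R by apply/eqP; rewrite eq_sym subr_eq -natrD Sk.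
have kle : k%:R + 1 <= beta * N.
  by apply: le_trans trunc_le; rewrite natr1 ler_nat.
have SN2 : N / 2 <= #|S|%:R.
  rewrite SN; have : beta * N <= 1 / 2 * N by rewrite ler_wpM2r // ltW.
  lra.
have eta0 : 0 < eta by lra.
have keta : 0 <= k%:R * eta by rewrite mulr_ge0 ?ler0n // ltW.
have S0 : 0 < #|S|%:R :> R by lra.
have aS : 16 <= alpha * #|S|%:R.
  have : alpha * (N / 2) <= alpha * #|S|%:R by rewrite ler_wpM2l // ltW.
  lra.
have mu_ge' : (gamma - eps) * #|S|%:R <= mu R (induced e S).
  by apply: le_trans mu_ge; rewrite ler_pM2r //; lra.
have [w wS gain] := deletion_density_gain a0 a4 g1 g2 eps0 epsa eG aS dle mu_ge'.
have SwN : #|S :\ w|%:R = #|S|%:R - 1 :> R.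
  by rewrite (cardsD1 w S) wS natrD addrAC subrr add0r.
have Sw0 : 0 < #|S :\ w|%:R :> R by lra.
have mu_w : (gamma - eps + k.+1%:R * eta) * #|S :\ w|%:R <= mu R (induced e (S :\ w)).
  rewrite -ler_pdivlMr //; apply: le_trans gain.
  rewrite -natr1 mulrDl mul1r addrA lerD //; first by rewrite ler_pdivlMr.
  rewrite /eta ler_wpM2l //; first by lra.
  rewrite lef_pV2 ?posrE // SN; have := ler0n R k; lra.
(* The degree is tested after the deletion, so at least one gain [eta > eps] has been made and a
   large minimum degree yields (ii). *)
have [dw|dw] := leP (mindeg (induced e (S :\ w)))%:R ((gamma - alpha) * #|S :\ w|%:R).
  right; exists (S :\ w); split=> //.
  by apply: etrans Sk; rewrite (cardsD1 w S) wS addnS addSn.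
left; exists (S :\ w); split; first by rewrite SwN SN; lra.
right; split=> //; apply: lt_le_trans mu_w; rewrite ltr_pM2r // -natr1; lra.
Qed.
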